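(* A real symmetric matrix $A$ has symmetric Kapranov rank two if and only if it has symmetric tropical rank two. (Equivalently, for every $n\ge 3$, the $3\times 3$ minors of an $n\times n$ symmetric matrix of indeterminates form a tropical basis.)
   Context: Let $\tilde K$ be the field of Hahn series $\sum_{\alpha\in A}c_\alpha t^\alpha$ ($A\subset\mathbb R$ well-ordered, $c_\alpha\in\mathbb C$); for nonzero $a\in\tilde K$, $\deg(a)$ is the smallest exponent with nonzero coefficient. A symmetric lift of a real symmetric matrix $A$ is a symmetric matrix $\tilde A$ over $\tilde K$ with all entries nonzero and $\deg(\tilde a_{i,j})=A_{i,j}$; the symmetric Kapranov rank of $A$ is the minimum rank of a symmetric lift. For an $r\times r$ submatrix of $A$ with row index set $I$ and column index set $J$, each bijection $\rho:I\to J$ gives a monomial $\prod_{i\in I}X_{i,\rho(i)}$ in commuting variables subject to $X_{i,j}=X_{j,i}$, with value $\sum_{i\in I}A_{i,\rho(i)}$; the submatrix is symmetrically tropically singular if the minimum value is attained by at least two distinct monomials. The symmetric tropical rank of $A$ is the largest $r$ such that $A$ has an $r\times r$ submatrix that is not symmetrically tropically singular. The $r\times r$ minors form a tropical basis if for every real symmetric $n\times n$ $A$: all $r\times r$ submatrices are symmetrically tropically singular iff $A$ has a symmetric lift of rank $\le r-1$. *)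

(* Defs.v *)
From HB Require Import structures.
From mathcomp Require Import all_boot all_order all_algebra all_fingroup.
From mathcomp Require Import all_classical all_reals.
From mathcomp Require Import Rstruct.
From mathcomp Require Import complex.
From Stdlib Require Rdefinitions.

Set Implicit Arguments.
Unset Strict Implicit.
Unset Printing Implicit Defensive.
Import Order.TTheory GRing.Theory Num.Theory.
Local Open Scope classical_set_scope.
Local Open Scope ring_scope.

Notation RR := Rdefinitions.R.
Notation CC := (complex RR).

(* A (candidate) Hahn series is its coefficient function  exponent |-> coefficient. *)
Definition series := RR -> CC.

Definition support (a : series) : set RR := [set x | a x != 0].

Definition well_ordered (S : set RR) : Prop :=
  forall B : set RR, B `<=` S -> B !=set0 ->
    exists2 m, B m & forall b, B b -> (m <= b).

Definition is_hahn (a : series) : Prop := well_ordered (support a).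

Definition hzero : series := fun _ => 0.
Definition hone : series := fun x => if x == 0 then 1 else 0.
Definition hadd (a b : series) : series := fun x => a x + b x.
Definition hopp (a : series) : series := fun x => - a x.
(* Cauchy product: (ab)_g = sum_{x + y = g} a_x b_y (finite sum for Hahn series) *)
Definition hmul (a b : series) : series :=
  fun g => \sum_(x \in [set: RR]) (a x * b (g - x)).

Definition hdeg_is (a : series) (d : RR) : Prop :=
  a d != 0 /\ forall x, a x != 0 -> (d <= x).

Definition hdet (r : nat) (M : 'I_r -> 'I_r -> series) : series :=
  \big[hadd/hzero]_(s : 'S_r)
     (if odd_perm s then hopp else id) (\big[hmul/hone]_(i < r) M i (s i)).

Definition hrank_le (n : nat) (M : 'I_n -> 'I_n -> series) (k : nat) : Prop :=
  forall f g : 'I_k.+1 -> 'I_n, injective f -> injective g ->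
    hdet (fun i j => M (f i) (g j)) = hzero.

Definition sym_lift (n : nat) (A : 'M[RR]_n) (L : 'I_n -> 'I_n -> series) : Prop :=
  (forall i j, L i j = L j i) /\
  (forall i j, is_hahn (L i j)) /\
  (forall i j, L i j <> hzero) /\
  (forall i j, hdeg_is (L i j) (A i j)).

Definition sym_kapranov_rank_is (n : nat) (A : 'M[RR]_n) (k : nat) : Prop :=
  (exists L, sym_lift A L /\ hrank_le L k) /\
  (forall L, sym_lift A L -> forall j, hrank_le L j -> (k <= j)%N).

(* Submatrix with rows f('I_r), columns g('I_r); a bijection rho : I -> J is
   encoded by s : 'S_r via rho (f i) = g (s i).  The monomial prod_i X_{i,rho i}
   with X_{p,q} = X_{q,p} is encoded by the multiplicity of each ordered pair
   (p,q) as an unordered pair {p,q}. *)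
Definition sym_monomial (n r : nat) (f g : 'I_r -> 'I_n) (s : 'S_r)
  : {ffun 'I_n * 'I_n -> nat} :=
  [ffun pq => #|[set i : 'I_r | ((f i, g (s i)) == pq) || ((g (s i), f i) == pq)]| ].

Definition trop_value (n r : nat) (A : 'M[RR]_n) (f g : 'I_r -> 'I_n) (s : 'S_r) : RR :=
  (\sum_(i < r) A (f i) (g (s i))).

Definition sym_trop_singular (n r : nat) (A : 'M[RR]_n) (f g : 'I_r -> 'I_n) : Prop :=
  exists s1 s2 : 'S_r,
    sym_monomial f g s1 != sym_monomial f g s2 /\
    trop_value A f g s1 = trop_value A f g s2 /\
    (forall s, (trop_value A f g s1 <= trop_value A f g s)).

Definition sym_tropical_rank_is (n : nat) (A : 'M[RR]_n) (k : nat) : Prop :=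
  (exists f g : 'I_k -> 'I_n, [/\ injective f, injective g & ~ sym_trop_singular A f g]) /\
  (forall r, (k < r)%N -> forall f g : 'I_r -> 'I_n,
      injective f -> injective g -> sym_trop_singular A f g).

(* Main.v *)
Require Import Defs.
From HB Require Import structures.
From mathcomp Require Import all_boot all_order all_algebra all_fingroup.
From mathcomp Require Import finmap all_classical all_reals Rstruct complex.
From mathcomp Require Import ring lra zify.

(** Over the Hahn field a nondegenerate symmetric form of rank two is
    hyperbolic, so up to scaling a symmetric lift of rank at most two is
    [x i + x j] for series [x i].  Scale the diagonal of the matrix to zero, call
    it [B], and read off what this requires: if [x i] and [x j] have different
    orders, then [- B i j] is half the distance of the orders; otherwise [B i j]
    is nonnegative and measures how far [x i] and [- x j] agree.

    Ties in the principal 3 x 3 minors make [max 0 (- B i j)] a pseudometric that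
    is collinear on triples, and one further minor excludes the exceptional
    quadruples, so the indices have positions on a line.  For every level
    [r >= 0], ties also show that the graph [r < B i j] is a disjoint union of
    complete bipartite graphs and isolated vertices; labelling the two sides of
    each component by opposite integers gives the coefficient of [x i] at level
    [r] above its order.

    Conversely, a vanishing minor of a lift forces a tie because, in size at most
    three, permutations with the same symmetric monomial have the same sign. *)

Set Implicit Arguments.
Unset Strict Implicit.
Unset Printing Implicit Defensive.
Import Order.TTheory GRing.Theory Num.Theory.
Local Open Scope ring_scope.

(** * The ring of finitely supported series *)

Definition finsupp : {pred RR -> CC} :=
  fun f => `[< finite_set [set x | f x != 0] >].

Lemma finsuppP (f : RR -> CC) :
  reflect (exists F : {fset RR}, forall x, x \notin F -> f x = 0)
          (f \in finsupp).
Proof.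
apply: (iffP (asboolP _)) => [/finite_fsetP[F eF]|[F hF]].
  exists F => x xF; apply/eqP; apply: contraNT xF => fx.
  by have : [set` F]%classic x by rewrite -eF.
apply: (finite_subfset F) => x /= fx.
by apply: contraNT fx => /hF ->.
Qed.

Lemma finsupp_zmod_closed : zmod_closed finsupp.
Proof.
split=> [|f g /finsuppP[F hF] /finsuppP[G hG]].
  by apply/finsuppP; exists fset0.
apply/finsuppP; exists (F `|` G)%fset => x.
by rewrite in_fsetU negb_or => /andP[/hF fx /hG gx]; rewrite !fctE fx gx subr0.
Qed.

HB.instance Definition _ := GRing.isZmodClosed.Build (RR -> CC) finsupp
  finsupp_zmod_closed.

(** The lifts constructed below have finite support; as a commutative ring, such series admit
    ordinary determinants. *)
Record hfin := HFin { hfun :> RR -> CC; hfunP : hfun \in finsupp }.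
HB.instance Definition _ := [isSub for hfun].
HB.instance Definition _ := [Choice of hfin by <:].
HB.instance Definition _ := [SubChoice_isSubZmodule of hfin by <:].

Lemma hmulE (a b : RR -> CC) (F : {fset RR}) (g : RR) :
  (forall x, x \notin F -> a x = 0) ->
  hmul a b g = \sum_(x <- F) a x * b (g - x).
Proof. by move=> hF; apply: fsbigTE => x /hF ->; rewrite mul0r. Qed.

Lemma hmul_finsupp (a b : RR -> CC) :
  a \in finsupp -> b \in finsupp -> hmul a b \in finsupp.
Proof.
move=> /finsuppP[F hF] /finsuppP[G hG]; apply/finsuppP.
exists [fset (x + y)%R | x in F, y in G]%fset => g gFG.
rewrite (hmulE _ _ hF) big_seq big1 // => x xF.
rewrite hG ?mulr0 //; apply: contra gFG => gx.
by apply/imfset2P; exists x => //; exists (g - x); rewrite // addrC subrK.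
Qed.

Lemma hmulC (a b : RR -> CC) : hmul a b = hmul b a.
Proof.
apply: funext => g; rewrite /hmul (@reindex_fsbigT _ _ _ _ _ (fun x => g - x)).
  by apply: eq_fsbigr => x _; rewrite subKr mulrC.
by exists (fun x => g - x) => x; rewrite subKr.
Qed.

Lemma hmulA (a b c : RR -> CC) : a \in finsupp -> b \in finsupp ->
  hmul a (hmul b c) = hmul (hmul a b) c.
Proof.
move=> /finsuppP[F hF] /finsuppP[G hG]; apply: funext => g.
have hFG y : y \notin [fset (x + y)%R | x in F, y in G]%fset ->
    forall x, x \in F -> b (y - x) = 0.
  move=> yFG x xF; apply: hG; apply: contra yFG => yx.
  by apply/imfset2P; exists x => //; exists (y - x); rewrite // addrC subrK.
rewrite (hmulE _ _ hF).
rewrite (@hmulE (hmul a b) _ [fset (x + y)%R | x in F, y in G]%fset); last first.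
  move=> y yFG; rewrite (hmulE _ _ hF) big_seq big1 // => x xF.
  by rewrite (hFG y) ?mulr0.
under [RHS]eq_bigr do rewrite (hmulE _ _ hF) big_distrl /=.
rewrite exchange_big /=; apply: eq_big_seq => x xF.
under [RHS]eq_bigr do rewrite -mulrA.
rewrite -big_distrr /=; congr (_ * _).
rewrite /hmul (@reindex_fsbigT _ _ _ _ _ (fun y => y - x)); last first.
  by exists (fun y => y + x) => y; rewrite ?addrK ?subrK.
rewrite (fsbigTE [fset (x + y)%R | x in F, y in G]%fset); last first.
  by move=> y /hFG ->; rewrite ?mul0r.
apply: eq_bigr => y _; congr (_ * c _).
by rewrite opprB addrA subrK.
Qed.

Lemma hmulDl (a b c : RR -> CC) : a \in finsupp -> b \in finsupp ->
  hmul (a + b) c = hmul a c + hmul b c.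
Proof.
move=> /finsuppP[F hF] /finsuppP[G hG]; apply: funext => g.
have hFa x : x \notin (F `|` G)%fset -> a x = 0.
  by rewrite in_fsetU negb_or => /andP[/hF].
have hFb x : x \notin (F `|` G)%fset -> b x = 0.
  by rewrite in_fsetU negb_or => /andP[_ /hG].
transitivity (hmul a c g + hmul b c g) => //.
rewrite (hmulE _ _ hFa) (hmulE _ _ hFb) -big_split /=.
rewrite (@hmulE _ _ (F `|` G)%fset) => [|x xFG]; last first.
  by rewrite fctE hFa ?hFb ?addr0.
by apply: eq_bigr => x _; rewrite fctE mulrDl.
Qed.

Definition monom (s : RR) : RR -> CC := fun x => if x == s then 1 else 0.

Lemma monom_finsupp (s : RR) : monom s \in finsupp.
Proof.
by apply/finsuppP; exists [fset s]%fset => x; rewrite in_fset1 /monom => /negPf->.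
Qed.

Lemma hmul_monom (s : RR) (b : RR -> CC) (g : RR) :
  hmul (monom s) b g = b (g - s).
Proof.
rewrite (@hmulE _ _ [fset s]%fset) => [|x].
  by rewrite big_seq_fset1 /monom eqxx mul1r.
by rewrite in_fset1 /monom => /negPf->.
Qed.

Definition hfin_one : hfin := HFin (monom_finsupp 0).
Definition hfin_mul (a b : hfin) : hfin :=
  HFin (hmul_finsupp (hfunP a) (hfunP b)).

Lemma hfin_mulA : associative hfin_mul.
Proof.
by move=> a b c; apply: val_inj; apply: hmulA; apply: hfunP.
Qed.

Lemma hfin_mulC : commutative hfin_mul.
Proof. by move=> a b; apply: val_inj; apply: hmulC. Qed.

Lemma hfin_mul1 : left_id hfin_one hfin_mul.
Proof.
by move=> a; apply: val_inj; apply: funext => g; rewrite /= hmul_monom subr0.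
Qed.

Lemma hfin_mulDl : left_distributive hfin_mul +%R.
Proof. by move=> a b c; apply: val_inj; apply: hmulDl; apply: hfunP. Qed.

Lemma hfin_one_neq0 : hfin_one != 0.
Proof.
apply/eqP => /(congr1 (fun a : hfin => a 0)) /= /eqP.
by rewrite /monom eqxx (negPf (oner_neq0 _)).
Qed.

HB.instance Definition _ := GRing.Zmodule_isComNzRing.Build hfin
  hfin_mulA hfin_mulC hfin_mul1 hfin_mulDl hfin_one_neq0.

Definition hmonom (s : RR) : hfin := HFin (monom_finsupp s).

Lemma hmonom_mul (s : RR) (a : hfin) (g : RR) :
  (hmonom s * a : hfin) g = a (g - s).
Proof. exact: hmul_monom. Qed.

Lemma hmonomD (s t : RR) : hmonom (s + t) = hmonom s * hmonom t.
Proof.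
apply: val_inj; apply: funext => g /=.
by rewrite hmul_monom /monom subr_eq addrC.
Qed.

Lemma hdet_hfin (r : nat) (M : 'M[hfin]_r) :
  hdet (fun i j => hfun (M i j)) = hfun (\det M).
Proof.
rewrite /hdet /determinant.
rewrite (big_morph hfun (op1 := hadd) (id1 := hzero)) //.
apply: eq_bigr => s _.
rewrite -(big_morph hfun (op1 := hmul) (id1 := hone) (op2 := *%R) (id2 := 1)) //.
by case: odd_perm; rewrite ?expr0 ?mul1r // expr1 mulN1r.
Qed.

Lemma finsupp_hahn (a : hfin) : is_hahn a.
Proof.
have /finsuppP[F hF] := hfunP a => B sBa [b Bb].
have sBF x : B x -> x \in F.
  by move=> /sBa /= ax; apply: contraNT ax => /hF ->.
have [c [Bc cF] cmin] : exists2 c : RR, B c /\ c \in F &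
    forall x, B x -> x \in enum_fset F -> c <= x.
  elim: (enum_fset F) => [|y s [c [Bc cF] hc]].
    by exists b => //; split=> //; apply: sBF.
  have [By|nBy] := pselect (B y); last first.
    exists c => // x Bx; rewrite inE => /orP[/eqP exy|/hc->//].
    by case: nBy; rewrite -exy.
  have [cy|yc] := leP c y.
    by exists c => // x Bx; rewrite inE => /orP[/eqP->//|/hc->].
  exists y; first by split=> //; apply: sBF.
  move=> x Bx; rewrite inE => /orP[/eqP->//|/hc cx].
  exact: le_trans (ltW yc) (cx Bx).
by exists c => // x Bx; apply: cmin => //; apply: sBF.
Qed.

(** * Monomials of a symmetric minor *)

Lemma sym_monomialE (n r : nat) (f g : 'I_r -> 'I_n) (s : 'S_r) pq :
  sym_monomial f g s pq =
  (\sum_(i < r) (((f i, g (s i)) == pq) || ((g (s i), f i) == pq)))%N.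
Proof.
rewrite ffunE -sum1_card big_mkcond; apply: eq_bigr => i _.
by rewrite unfold_in /= asboolb; case: (_ || _).
Qed.

(** The point is that the product depends on [s] only through its symmetric monomial. Each unordered
    pair is represented once, with [pq.1 <= pq.2]. *)
Lemma prod_sym_monomial (K : comNzRingType) (n r : nat) (f g : 'I_r -> 'I_n)
    (F : 'I_n -> 'I_n -> K) (s : 'S_r) : (forall i j, F i j = F j i) ->
  \prod_i F (f i) (g (s i)) =
  \prod_(pq : 'I_n * 'I_n | (pq.1 <= pq.2)%N)
     F pq.1 pq.2 ^+ sym_monomial f g s pq.
Proof.
move=> symF.
under [RHS]eq_bigr do rewrite sym_monomialE expr_sum.
rewrite exchange_big /=; apply: eq_bigr => i _.
set p := f i; set q := g (s i).
have [pq|/ltnW qp] := leqP p q.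
  rewrite (bigD1 (p, q)) //= eqxx expr1 big1 ?mulr1 // => -[u v] /= /andP[uv].
  rewrite eq_sym => /negPf nepq; rewrite nepq.
  case: eqP => [[eu ev]|]; rewrite ?expr0 //.
  have epq : p = q by apply: val_inj; apply: anti_leq; rewrite /= pq eu ev.
  by move: nepq; rewrite -eu -ev epq eqxx.
rewrite (bigD1 (q, p)) //= eqxx orbT expr1 symF big1 ?mulr1 // => -[u v] /= /andP[uv].
rewrite eq_sym orbC => /negPf nepq; rewrite nepq.
case: eqP => [[eu ev]|]; rewrite ?expr0 //.
have epq : p = q by apply: val_inj; apply: anti_leq; rewrite /= qp eu ev uv.
by move: nepq; rewrite -eu -ev epq eqxx.
Qed.

(** The multiplicity of [(f a, g (s a))] drops: the other rows contribute equally, while after the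
    swap neither row [a] nor row [b] yields this pair. *)
Lemma sym_monomial_tperm (n r : nat) (f g : 'I_r -> 'I_n) (s : 'S_r) a b :
  injective f -> injective g -> a != b ->
  sym_monomial f g (tperm a b * s)%g != sym_monomial f g s.
Proof.
move=> injf injg ab; apply/eqP => /ffunP /(_ (f a, g (s a))).
rewrite !sym_monomialE (bigD1 a) //= (bigD1 b) 1?eq_sym //=.
rewrite [in RHS](bigD1 a) //= [in RHS](bigD1 b) 1?eq_sym //=.
rewrite !permM tpermL tpermR eqxx /=.
under eq_bigr => i /andP[ia ib] do rewrite permM tpermD ?[_ == i]eq_sym //.
have nsab : s b != s a by rewrite (inj_eq perm_inj) eq_sym.
have -> : ((f a, g (s b)) == (f a, g (s a))) ||
          ((g (s b), f a) == (f a, g (s a))) = false.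
  apply/negP => /orP[/eqP[/injg /eqP]|/eqP[e1 e2]]; first exact/negP.
  by have /injg /eqP := etrans e1 e2; apply/negP.
have -> : ((f b, g (s a)) == (f a, g (s a))) ||
          ((g (s a), f b) == (f a, g (s a))) = false.
  apply/negP => /orP[/eqP[/injf /eqP]|/eqP[e1 e2]]; first by apply/negP; rewrite eq_sym.
  by have /injf /eqP := etrans e2 e1; apply/negP; rewrite eq_sym.
by lia.
Qed.

Lemma ord_le3_eq (r : nat) (a b c x : 'I_r) : (r <= 3)%N ->
  a != b -> a != c -> b != c -> x != a -> x != b -> x = c.
Proof.
rewrite -!val_eqE /= => r3 ab ac bc xa xb; apply: val_inj => /=.
by have := (ltn_ord a, ltn_ord b, ltn_ord c, ltn_ord x) => -[[[]]]; lia.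
Qed.

Lemma perm_neq1 (T : finType) (t : {perm T}) : t != 1%g -> exists a, t a != a.
Proof.
move=> t1; apply/existsP; apply: contraNT t1; rewrite negb_exists => /forallP h.
by apply/eqP/permP => x; rewrite perm1; apply/eqP; have := h x; rewrite negbK.
Qed.

Lemma odd_perm_tperm (r : nat) (t : 'S_r) : (r <= 3)%N -> odd_perm t ->
  exists a b, a != b /\ t = tperm a b.
Proof.
move=> r3 odt.
have /perm_neq1[a ta] : t != 1%g by apply: contraTneq odt => ->; rewrite odd_perm1.
exists a, (t a); split; first by rewrite eq_sym.
(* [u] is even and fixes [a], so it permutes at most two other points and must be the identity. *)
pose u := (t * tperm a (t a))%g.
suff u1 : u = 1%g.
  by rewrite -[LHS]mulg1 -(tperm2 a (t a)) mulgA -/u u1 mul1g.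
have ua : u a = a by rewrite permM tpermR.
have evu : ~~ odd_perm u by rewrite odd_permM odd_tperm odt eq_sym ta.
apply/eqP; apply: contraNT evu => /perm_neq1[b ub].
suff -> : u = tperm b (u b) by rewrite odd_tperm eq_sym ub.
have ba : b != a by apply: contraNneq ub => ->; rewrite ua.
have uba : u b != a by rewrite -[X in _ != X]ua (inj_eq perm_inj).
apply/permP => x; case: tpermP => [->//|->|/eqP xb /eqP xub].
  apply: (@ord_le3_eq _ a (u b)) => //; try by rewrite eq_sym.
    by rewrite -[X in _ != X]ua (inj_eq perm_inj).
  by rewrite (inj_eq perm_inj).
have -> // : x = a by apply: (@ord_le3_eq _ b (u b)) => //; rewrite eq_sym.
Qed.

(** On at most three points, permutations of opposite sign differ by a transposition, which changes
    the monomial. *)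
Lemma sym_monomial_parity (n r : nat) (f g : 'I_r -> 'I_n) (s1 s2 : 'S_r) :
  (r <= 3)%N -> injective f -> injective g ->
  sym_monomial f g s1 = sym_monomial f g s2 -> odd_perm s1 = odd_perm s2.
Proof.
move=> r3 injf injg e; apply/eqP; apply: contra_eqT e => odd12.
have [|a [b [ab et]]] := @odd_perm_tperm _ (s1 * s2^-1)%g r3.
  by rewrite odd_permM odd_permV; move: odd12; do 2!case: odd_perm.
by rewrite -[s1](mulgKV s2) et sym_monomial_tperm.
Qed.

(** * Vanishing minors and tropical singularity *)

(* [c] may be zero, which makes the relation compatible with products. *)
Definition lead (a : series) (d : RR) (c : CC) : Prop :=
  (forall x, x < d -> a x = 0) /\ a d = c.

Lemma lead_mul (a b : series) (d e : RR) (c c' : CC) :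
  lead a d c -> lead b e c' -> lead (hmul a b) (d + e) (c * c').
Proof.
move=> [a0 <-] [b0 <-]; have ab0 g x : g <= d + e -> x != d \/ g < d + e ->
    a x * b (g - x) = 0.
  move=> gde xg; have [/a0->|dx] := ltP x d; first by rewrite mul0r.
  rewrite b0 ?mulr0 //; case: xg => [xd|]; last by lra.
  have : d < x by rewrite lt_neqAle eq_sym xd.
  by lra.
split=> [g gde|]; first by apply: fsbig1 => x _; apply: ab0; [exact: ltW|right].
rewrite /hmul (fsbigTE [fset d]%fset) ?big_seq_fset1 => [|x].
  by rewrite [d + e]addrC addrK.
by rewrite in_fset1 => xd; apply: ab0 => //; left.
Qed.

Lemma lead_prod (r : nat) (a : 'I_r -> series) (d : 'I_r -> RR) (c : 'I_r -> CC) :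
  (forall i, lead (a i) (d i) (c i)) ->
  lead (\big[hmul/hone]_i a i) (\sum_i d i) (\prod_i c i).
Proof.
move=> lea; apply: (big_ind3 lead) => // [|a1 d1 c1 a2 d2 c2]; last exact: lead_mul.
by split=> [x x0|]; rewrite /hone ?eqxx // lt_eqF.
Qed.

Lemma hdetE (r : nat) (M : 'I_r -> 'I_r -> series) (x : RR) :
  hdet M x = \sum_(s : 'S_r) (-1) ^+ s * (\big[hmul/hone]_i M i (s i)) x.
Proof.
rewrite /hdet (big_morph (fun a : series => a x) (op1 := +%R) (id1 := 0)) //.
by apply: eq_bigr => s _; case: odd_perm; rewrite ?mul1r // expr1 mulN1r.
Qed.

(** At the minimal exponent only optimal permutations contribute to the determinant. If they shared
    one monomial, they would all contribute the same nonzero complex number, and the sum could not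
    vanish. *)
Lemma singular_of_hdet0 (n r : nat) (A : 'M[RR]_n) (L : 'I_n -> 'I_n -> series)
    (f g : 'I_r -> 'I_n) :
  (r <= 3)%N -> injective f -> injective g -> sym_lift A L ->
  hdet (fun i j => L (f i) (g j)) = hzero -> sym_trop_singular A f g.
Proof.
move=> r3 injf injg [symL [_ [_ degL]]] det0; apply: contrapT => nsing.
pose v := trop_value A f g.
pose s0 := [arg min_(s < 1%g : 'S_r) v s]%O.
have s0min s : v s0 <= v s by rewrite /s0; case: arg_minP => // i _; apply.
have mon0 s : v s = v s0 -> sym_monomial f g s = sym_monomial f g s0.
  move=> vs; apply/eqP; apply: contrapT => /negP neq; apply: nsing.
  by exists s, s0; split; [|split=> // t; rewrite -/(v s) vs; apply: s0min].
pose F i j := L i j (A i j).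
have symF i j : F i j = F j i.
  have [Fij mij] := degL i j; have [Fji mji] := degL j i.
  rewrite symL in Fij mij; have e : A i j = A j i.
    by apply: le_anti; rewrite mij // mji.
  by rewrite /F symL e.
have leadL i j : lead (L i j) (A i j) (F i j).
  split=> // x xA; apply/eqP; apply: contraTT xA => Lx; rewrite -leNgt.
  exact: (degL i j).2.
have := congr1 (fun a : series => a (v s0)) det0.
rewrite hdetE (bigID (fun s => v s == v s0)) /= [X in _ + X]big1 => [|s vs]; last first.
  have [+ _] := @lead_prod r _ _ _ (fun i => leadL (f i) (g (s i))).
  move=> -> //; rewrite ?mulr0 // -/(trop_value A f g s) lt_neqAle eq_sym vs.
  exact: s0min.
rewrite addr0 (eq_bigr (fun=> (-1) ^+ s0 * \prod_i F (f i) (g (s0 i))))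
  => [|s /eqP vs]; last first.
  rewrite (sym_monomial_parity r3 injf injg (mon0 _ vs)); congr (_ * _).
  have [_] := @lead_prod r _ _ _ (fun i => leadL (f i) (g (s i))).
  rewrite -/(trop_value A f g s) -/(v s) vs => ->.
  by rewrite !(@prod_sym_monomial _ _ _ _ _ F) // mon0.
rewrite sumr_const => /eqP; apply/negP.
rewrite -mulr_natr !mulf_neq0 ?signr_eq0 //.
  by apply/prodf_neq0 => i _; exact: (degL _ _).1.
rewrite pnatr_eq0 -lt0n; apply/card_gt0P; exists s0.
exact: eqxx.
Qed.

(** * Expansion of a minor along its first row *)

Lemma sym_monomial_lift (n r : nat) (f g : 'I_r.+1 -> 'I_n) j (t : 'S_r) pq :
  sym_monomial f g (lift_perm ord0 j t) pq =
  (((f ord0, g j) == pq) || ((g j, f ord0) == pq) +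
   sym_monomial (f \o lift ord0) (g \o lift j) t pq)%N.
Proof.
rewrite !sym_monomialE big_ord_recl lift_perm_id; congr addn.
by apply: eq_bigr => i _; rewrite /= lift_perm_lift.
Qed.

Lemma trop_value_lift (n r : nat) (A : 'M[RR]_n) (f g : 'I_r.+1 -> 'I_n) j (t : 'S_r) :
  trop_value A f g (lift_perm ord0 j t) =
  A (f ord0) (g j) + trop_value A (f \o lift ord0) (g \o lift j) t.
Proof.
rewrite /trop_value big_ord_recl lift_perm_id; congr (_ + _).
by apply: eq_bigr => i _; rewrite /= lift_perm_lift.
Qed.

Lemma lift_perm_ex (r : nat) (s : 'S_r.+1) :
  exists t : 'S_r, s = lift_perm ord0 (s ord0) t.
Proof.
have sl i : s ord0 != s (lift ord0 i) by rewrite (inj_eq perm_inj) neq_lift.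
pose h i := sval (unlift_some (sl i)).
have hE i : s (lift ord0 i) = lift (s ord0) (h i) by rewrite /h; case: unlift_some.
have injh : injective h.
  move=> i j e; apply: (@lift_inj _ ord0); apply: (@perm_inj _ s).
  by rewrite !hE e.
exists (perm injh); apply/permP => x.
case: (unliftP ord0 x) => [y|] ->; last by rewrite lift_perm_id.
by rewrite lift_perm_lift permE.
Qed.

(* Expanding along the first row at the entry used by an optimal permutation
   preserves uniqueness of the optimal monomial. *)
Lemma singular_succ (n r : nat) (A : 'M[RR]_n) :
  (forall f g : 'I_r -> 'I_n, injective f -> injective g ->
     sym_trop_singular A f g) ->
  forall f g : 'I_r.+1 -> 'I_n, injective f -> injective g ->
     sym_trop_singular A f g.
Proof.
move=> sing f g injf injg; pose v := trop_value A f g.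
pose s0 := [arg min_(s < 1%g : 'S_r.+1) v s]%O.
have s0min s : v s0 <= v s by rewrite /s0; case: arg_minP => // i _; apply.
have [t0 et0] := lift_perm_ex s0.
have [||t1 [t2 [neq [e12 tmin]]]] := sing (f \o lift ord0) (g \o lift (s0 ord0)).
- exact: inj_comp injf lift_inj.
- exact: inj_comp injg lift_inj.
exists (lift_perm ord0 (s0 ord0) t1), (lift_perm ord0 (s0 ord0) t2); split.
  apply: contra neq => /eqP/ffunP e; apply/eqP/ffunP => pq.
  by have := e pq; rewrite !sym_monomial_lift => /addnI.
split=> [|s]; first by rewrite !trop_value_lift e12.
apply: le_trans (s0min s); rewrite /v et0 lift_perm_id !trop_value_lift.
by rewrite lerD2l.
Qed.

(** * Matrices all of whose 3 x 3 minors are tropically singular *)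

Definition minors3_singular (n : nat) (A : 'M[RR]_n) : Prop :=
  forall f g : 'I_3 -> 'I_n, injective f -> injective g ->
    sym_trop_singular A f g.

Definition triple (T : Type) (x y z : T) : 'I_3 -> T := fun i => nth x [:: x; y; z] i.

Lemma triple_inj (T : eqType) (x y z : T) :
  x != y -> x != z -> y != z -> injective (triple x y z).
Proof.
move=> xy xz yz i j; apply: contra_eq => ij; rewrite /triple nth_uniq //=.
by rewrite !inE negb_or xy xz yz.
Qed.

Lemma big_ord3 (T : Type) (idx : T) (op : Monoid.law idx) (F : 'I_3 -> T) :
  \big[op/idx]_i F i = op (F ord0) (op (F (lift ord0 ord0)) (F ord_max)).
Proof.
rewrite !big_ord_recl big_ord0 Monoid.mulm1.
by congr (op _ (op _ (F _))); apply: val_inj.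
Qed.

Lemma perm3_caseP (s : 'S_3) :
  let e := (val (s ord0), val (s (lift ord0 ord0)), val (s ord_max)) in
  e \in [:: (0, 1, 2); (0, 2, 1); (1, 0, 2); (1, 2, 0); (2, 0, 1); (2, 1, 0)]%N.
Proof.
have n01 : s ord0 != s (lift ord0 ord0) by rewrite (inj_eq perm_inj).
have n02 : s ord0 != s ord_max by rewrite (inj_eq perm_inj).
have n12 : s (lift ord0 ord0) != s ord_max by rewrite (inj_eq perm_inj).
move: n01 n02 n12.
move: (s ord0) (s (lift ord0 ord0)) (s ord_max).
by move=> [[|[|[|?]]] ?] // [[|[|[|?]]] ?] // [[|[|[|?]]] ?].
Qed.

Lemma trop_value3 (n : nat) (A : 'M[RR]_n) (i1 i2 i3 j1 j2 j3 : 'I_n) (s : 'S_3) :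
  trop_value A (triple i1 i2 i3) (triple j1 j2 j3) s =
  A i1 (nth j1 [:: j1; j2; j3] (s ord0)) +
  (A i2 (nth j1 [:: j1; j2; j3] (s (lift ord0 ord0))) +
   A i3 (nth j1 [:: j1; j2; j3] (s ord_max))).
Proof. by rewrite /trop_value big_ord3. Qed.

(** Both permutations of a tie would be the identity. Reordering the columns puts any permutation on
    the diagonal, so this form covers them all. *)
Lemma minor_not_unique (n : nat) (A : 'M[RR]_n) (i1 i2 i3 j1 j2 j3 : 'I_n) :
  minors3_singular A ->
  i1 != i2 -> i1 != i3 -> i2 != i3 -> j1 != j2 -> j1 != j3 -> j2 != j3 ->
  let m : RR := A i1 j1 + A i2 j2 + A i3 j3 in
  m < A i1 j1 + A i2 j3 + A i3 j2 -> m < A i1 j2 + A i2 j1 + A i3 j3 ->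
  m < A i1 j2 + A i2 j3 + A i3 j1 -> m < A i1 j3 + A i2 j1 + A i3 j2 ->
  m < A i1 j3 + A i2 j2 + A i3 j1 -> False.
Proof.
move=> sing i12 i13 i23 j12 j13 j23 m h1 h2 h3 h4 h5.
have [s1 [s2 [neq [e12 smin]]]] :=
  sing _ _ (triple_inj i12 i13 i23) (triple_inj j12 j13 j23).
have val_min s : (forall t, trop_value A (triple i1 i2 i3) (triple j1 j2 j3) s <=
    trop_value A (triple i1 i2 i3) (triple j1 j2 j3) t) -> s = 1%g.
  move=> /(_ 1%g); rewrite !trop_value3 !perm1 /=.
  have := perm3_caseP s; rewrite /= !inE.
  move=> /or4P[||| /or3P[]] /eqP[e0 e1 e2]; rewrite e0 e1 e2 /= => h0;
    try by exfalso; rewrite /m in h1 h2 h3 h4 h5; lra.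
  apply/permP => x; rewrite perm1; apply: val_inj.
  by case: x => [[|[|[|//]]] lt]; [apply: etrans e0|apply: etrans e1|apply: etrans e2];
      congr (val (s _)); apply: val_inj.
move: neq; rewrite (val_min s1) // (val_min s2) ?eqxx // => t.
by rewrite -e12.
Qed.

(** The columns of a principal minor are rotated so that the identity becomes a 3-cycle. By symmetry
    the reverse cycle has the same monomial, so only the four other permutations are compared. *)
Lemma cycle_not_unique (n : nat) (A : 'M[RR]_n) (i j k : 'I_n) :
  minors3_singular A -> i != j -> i != k -> j != k ->
  let m : RR := A i j + A j k + A k i in
  m < A i i + A j j + A k k -> m < A i j + A j i + A k k ->
  m < A i i + A j k + A k j -> m < A i k + A j j + A k i -> False.
Proof.
move=> sing ij ik jk m h1 h2 h3 h4.
have ki : k != i by rewrite eq_sym.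
have ji : j != i by rewrite eq_sym.
have [s1 [s2 [neq [e12 smin]]]] :=
  sing _ _ (triple_inj ij ik jk) (triple_inj jk ji ki).
pose M := sym_monomial (triple i j k) (triple j k i).
have mon_min s : (forall t, trop_value A (triple i j k) (triple j k i) s <=
    trop_value A (triple i j k) (triple j k i) t) -> M s = M 1%g.
  move=> /(_ 1%g); rewrite !trop_value3 !perm1 /=.
  have := perm3_caseP s; rewrite /= !inE.
  move=> /or4P[||| /or3P[]] /eqP[e0 e1 e2]; rewrite e0 e1 e2 /= => h0;
    try by exfalso; rewrite /m in h1 h2 h3 h4; lra.
  - by apply/ffunP => pq; rewrite /M !sym_monomialE !big_ord3 /triple !perm1 e0 e1 e2.
  - apply/ffunP => pq; rewrite /M !sym_monomialE !big_ord3 /triple !perm1 e0 e1 e2 /=.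
    rewrite (orbC ((i, k) == pq)) (orbC ((j, i) == pq)) (orbC ((k, j) == pq)).
    by rewrite addnC -addnA.
by move: neq; rewrite -/M (mon_min s1) // (mon_min s2) ?eqxx // => t; rewrite -e12.
Qed.

(** Every permutation meets each row and each column once, so all values change by the same
    constant. *)
Lemma trop_value_shift (n r : nat) (A B : 'M[RR]_n) (c : 'I_n -> RR)
    (f g : 'I_r -> 'I_n) (s : 'S_r) :
  (forall i j, A i j = B i j + c i + c j) ->
  trop_value A f g s =
  trop_value B f g s + (\sum_i c (f i) + \sum_i c (g i)).
Proof.
move=> AB; rewrite [X in _ + (_ + X)](reindex_inj (@perm_inj _ s)) /= -!big_split.
by apply: eq_bigr => i _; rewrite AB -addrA.
Qed.

Lemma minors3_singular_shift (n : nat) (A B : 'M[RR]_n) (c : 'I_n -> RR) :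
  (forall i j, A i j = B i j + c i + c j) ->
  minors3_singular A -> minors3_singular B.
Proof.
move=> AB sing f g injf injg; have [s1 [s2 [neq [e12 smin]]]] := sing f g injf injg.
rewrite !(trop_value_shift _ _ _ AB) in e12.
exists s1, s2; split=> //; split=> [|s]; first exact: addIr e12.
by have := smin s; rewrite !(trop_value_shift _ _ _ AB) lerD2r.
Qed.

(** Closing paths of length three makes every component of the graph [x < B i j] complete bipartite
    or a single vertex. *)
Lemma path3_gt (n : nat) (B : 'M[RR]_n) (x : RR) (i j k l : 'I_n) :
  (forall i j, B i j = B j i) -> (forall i, B i i = 0) -> minors3_singular B ->
  0 <= x -> x < B i j -> x < B j k -> x < B k l -> x < B i l.
Proof.
move=> symB B0 sing x0 xij xjk xkl.
have neq p q : x < B p q -> p != q.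
  by move=> xpq; apply: contraTneq xpq => ->; rewrite B0 -leNgt.
have [[ij jk] kl] := (neq _ _ xij, neq _ _ xjk, neq _ _ xkl).
have [<-//|ik] := eqVneq k i.
have [->//|jl] := eqVneq l j; rewrite eq_sym in ik; rewrite eq_sym in jl.
(* A positive [B p s] would make the diagonal of the principal minor the only optimum; a negative
   one, the transposition of [p] and [s]. *)
have tri0 p q s : x < B p q -> x < B q s -> p != s -> B p s = 0.
  move=> xpq xqs ps; have [pq qs] := (neq _ _ xpq, neq _ _ xqs).
  have := (symB p q, symB q s, symB p s, B0 p, B0 q, B0 s) => -[[[[[]]]]] *.
  apply/eqP; rewrite eq_le !leNgt; apply/andP; split; apply/negP => ?.
    by apply: (@minor_not_unique _ B p q s p q s sing) => //; lra.
  have sq : s != q by rewrite eq_sym.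
  have sp : s != p by rewrite eq_sym.
  have qp : q != p by rewrite eq_sym.
  by apply: (@minor_not_unique _ B p q s s q p sing) => //; lra.
have Bik := tri0 _ _ _ xij xjk ik.
have Bjl := tri0 _ _ _ xjk xkl jl.
have [eil|il] := eqVneq i l.
  move: xkl; rewrite -eil symB Bik; lra.
rewrite ltNge; apply/negP => Bil.
have kj : k != j by rewrite eq_sym.
have lk : l != k by rewrite eq_sym.
have lj : l != j by rewrite eq_sym.
have := (symB i j, symB j k, symB k l, symB i k, symB j l, symB i l, B0 j, B0 k).
move=> -[[[[[[[]]]]]]] *.
(* If [B i l <= x], this minor has the only optimum [B i l + B k k + B j j]. *)
by apply: (@minor_not_unique _ B i k j l k j sing) => //; lra.
Qed.

(** * Positions of the indices on a line *)

Definition axis_dist (n : nat) (B : 'M[RR]_n) (i j : 'I_n) : RR := Num.max 0 (- B i j).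

Lemma axis_distP (n : nat) (B : 'M[RR]_n) (i j : 'I_n) :
  (B i j < 0 /\ axis_dist B i j = - B i j) \/ (0 <= B i j /\ axis_dist B i j = 0).
Proof.
rewrite /axis_dist; have [B0|B0] := ltP (B i j) 0; [left|right]; split=> //.
  by rewrite max_r // oppr_ge0 ltW.
by rewrite max_l // oppr_le0.
Qed.

(** Here [a] is the least off-diagonal entry of a principal minor with zero diagonal. The last two
    hypotheses deny a unique optimum to the transposition of value [2 * a] and to the 3-cycles of
    value [a + b + c]. *)
Lemma tie_collinear (a b c : RR) : a <= b -> a <= c ->
  (a < 0 -> a < b -> a < c -> a < b + c -> False) ->
  (a + b + c < 0 -> b + c < a -> a + c < b -> a + b < c -> False) ->
  Num.max 0 (- a) = Num.max 0 (- b) + Num.max 0 (- c).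
Proof.
move=> ab ac N1 N2.
have maxN (x : RR) : x < 0 -> Num.max 0 (- x) = - x.
  by move=> x0; rewrite max_r // oppr_ge0 ltW.
have max0 (x : RR) : 0 <= x -> Num.max 0 (- x) = 0.
  by move=> x0; rewrite max_l // oppr_le0.
have [a0|a0] := leP 0 a; first by rewrite !max0 ?addr0 //; lra.
have [b0|b0] := leP 0 b.
  have [eac|neac] := eqVneq a c; first by rewrite (max0 b) // -eac add0r.
  have lac : a < c by rewrite lt_neqAle neac.
  by case: N1 => //; lra.
have [c0|c0] := leP 0 c.
  have [eab|neab] := eqVneq a b; first by rewrite (max0 c) // -eab addr0.
  have lab : a < b by rewrite lt_neqAle neab.
  by case: N1 => //; lra.
rewrite !maxN //; case: (ltgtP a (b + c)) => [labc|lbca|->]; last by rewrite opprD.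
  by case: N1 => //; lra.
by case: N2 => //; lra.
Qed.

Lemma axis_dist_collinear (n : nat) (B : 'M[RR]_n) (i j k : 'I_n) :
  (forall i j, B i j = B j i) -> (forall i, B i i = 0) -> minors3_singular B ->
  let d := axis_dist B in
  [\/ d i j = d i k + d j k, d i k = d i j + d j k | d j k = d i j + d i k].
Proof.
move=> symB B0 sing d.
have dxx p : d p p = 0 by rewrite /d /axis_dist B0 oppr0 maxxx.
have dsym p q : d p q = d q p by rewrite /d /axis_dist symB.
have [<-|ij] := eqVneq i j; first by apply: Or32; rewrite dxx add0r.
have [<-|ik] := eqVneq i k; first by apply: Or31; rewrite dxx add0r dsym.
have [<-|jk] := eqVneq j k; first by apply: Or31; rewrite dxx addr0.
have main p q s : p != q -> p != s -> q != s -> B p q <= B p s -> B p q <= B q s ->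
    d p q = d p s + d q s.
  move=> pq ps qs l1 l2; have qp : q != p by rewrite eq_sym.
  have := (symB q p, symB s p, symB s q, B0 p, B0 q, B0 s).
  move=> -[[[[[e1 e2] e3] e4] e5] e6]; apply: tie_collinear => // *.
    by apply: (@minor_not_unique _ B p q s q p s sing pq ps qs qp qs ps); lra.
  by apply: (@cycle_not_unique _ B p q s sing pq ps qs); lra.
have [ji ki kj] : [/\ j != i, k != i & k != j] by rewrite !(eq_sym j) !(eq_sym k).
have [l1|/ltW l1] := leP (B i j) (B i k).
  have [l2|/ltW l2] := leP (B i j) (B j k); first by apply: Or31; exact: main.
  apply: Or33; rewrite (dsym i j) (dsym i k); apply: main => //.
    by rewrite [leRHS]symB.
  by rewrite [leRHS]symB (le_trans l2).
have [l2|/ltW l2] := leP (B i k) (B j k).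
  by apply: Or32; rewrite (dsym j k); apply: main => //; rewrite [leRHS]symB.
apply: Or33; rewrite (dsym i j) (dsym i k); apply: main => //.
  by rewrite [leRHS]symB (le_trans l2).
by rewrite [leRHS]symB.
Qed.

(** Positions are distances from one end [a] of a diameter; every index lies between [a] and the
    other end [b]. *)
Lemma axis_positions (n : nat) (B : 'M[RR]_n) :
  (forall i j, B i j = B j i) -> (forall i, B i i = 0) -> minors3_singular B ->
  exists p : 'I_n -> RR, forall i j, axis_dist B i j = `|p i - p j|.
Proof.
case: n B => [|n] B symB B0 sing; first by exists (fun=> 0) => -[].
pose d := axis_dist B.
have d0 i j : 0 <= d i j by rewrite /d /axis_dist le_max lexx.
have dxx p : d p p = 0 by rewrite /d /axis_dist B0 oppr0 maxxx.
have dsym p q : d p q = d q p by rewrite /d /axis_dist symB.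
have [a [b dmax]] : exists a b, forall i j, d i j <= d a b.
  pose ab := [arg max_(pq > (ord0, ord0) : 'I_n.+1 * 'I_n.+1) d pq.1 pq.2]%O.
  exists ab.1, ab.2 => i j; rewrite /ab; case: arg_maxP => // pq _ h.
  exact: (h (i, j)).
have dab i : d i b = d a b - d a i.
  have := dmax i b; have := dmax a i; have := (d0 a i, d0 i b) => -[].
  by case: (axis_dist_collinear a b i symB B0 sing); rewrite -/d (dsym b i); lra.
exists (d a) => i j; rewrite -/(d i j).
suff [] : d i j = d a i - d a j \/ d i j = d a j - d a i.
- by move=> e; rewrite -e ger0_norm.
- by move=> e; rewrite distrC -e ger0_norm.
case: (axis_dist_collinear a i j symB B0 sing); rewrite -/d.
- by move=> e; left; lra.
- by move=> e; right; lra.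
move=> eij.
have [aj0|aj0] := eqVneq (d a j) 0; first by left; lra.
have [ai0|ai0] := eqVneq (d a i) 0; first by right; lra.
have {}aj0 : 0 < d a j by rewrite lt_neqAle eq_sym aj0 d0.
have {}ai0 : 0 < d a i by rewrite lt_neqAle eq_sym ai0 d0.
(* The other two collinear orders of [i], [j], [b] would force [d a i] or [d a j] to vanish. *)
have edab : d a b = d a i + d a j.
  by case: (axis_dist_collinear i j b symB B0 sing); rewrite -/d (dab i) (dab j); lra.
(* The four points form a quadrilateral with equal opposite sides whose
   diagonals are the diameter; this is the one configuration of four points
   that is collinear on triples but not on the line. *)
have dneq p q : 0 < d p q -> p != q.
  by move=> pq; apply: contraTneq pq => ->; rewrite dxx ltxx.
have Bneg p q : 0 < d p q -> B p q = - d p q.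
  by rewrite /d; case: (axis_distP B p q) => -[_ ->]; rewrite ?opprK ?ltxx.
have ib0 : 0 < d i b by rewrite dab; lra.
have jb0 : 0 < d j b by rewrite dab; lra.
have ab0 : 0 < d a b by lra.
have ij0 : 0 < d i j by lra.
have := (Bneg _ _ ib0, Bneg _ _ jb0, Bneg _ _ ab0, Bneg _ _ ij0, Bneg _ _ ai0,
  Bneg _ _ aj0, symB b a, symB b j, symB i a, B0 a, B0 b, dab i, dab j).
move=> -[[[[[[[[[[[[e1 e2] e3] e4] e5] e6] e7] e8] e9] e10] e11] e12] e13].
exfalso; apply: (@minor_not_unique _ B a b i b a j sing);
  rewrite ?dneq // 1?dsym //; lra.
Qed.

(** [N i] is the set of neighbours of [i] and [S i] its own side of the component. The absolute
    value of a label encodes a representative of the component, and the sign tells whether this lies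
    on the side of [i]. *)
Lemma antipodal_labels (K : numDomainType) (n : nat) (H : rel 'I_n) :
  symmetric H -> irreflexive H ->
  (forall i j k l, H i j -> H j k -> H k l -> H i l) ->
  exists x : 'I_n -> K, forall i j, (x i + x j == 0) = H i j.
Proof.
move=> symH irrH path3.
pose N i := [set k | H i k].
pose S i := [set k | (k == i) || [exists q, H i q && H q k]].
have SN i j : H i j -> S i = N j.
  move=> ij; apply/setP => k; rewrite !inE; apply/orP/idP => [[/eqP->|/existsP[q]]|jk].
  - by rewrite symH.
  - by case/andP=> iq qk; apply: path3 qk; [rewrite symH; exact: ij|].
  - by right; apply/existsP; exists j; rewrite ij.
have disj i k : k \in S i -> k \notin N i.
  rewrite !inE => /orP[/eqP->|/existsP[q /andP[iq qk]]]; first by rewrite irrH.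
  by apply/negP => ik; have := irrH i; rewrite (path3 _ _ _ _ iq qk) // symH.
pose m i := odflt i [pick k in S i :|: N i].
have mP i : m i \in S i :|: N i.
  by rewrite /m; case: pickP => //= /(_ i); rewrite !inE eqxx.
(* The successor keeps labels nonzero, so equal labels never cancel. *)
pose x i : K := if m i \in S i then (m i).+1%:R else - (m i).+1%:R.
exists x => i j; apply/idP/idP => [|ij].
  (* The common representative lies on the side of [p] and is adjacent to [q]. *)
  have far p q : m p = m q -> m p \in S p -> m q \notin S q -> H p q.
    move=> epq mSp mSq; have := mP q; rewrite finset.in_setU (negPf mSq) -epq inE => qm.
    move: mSp; rewrite inE => /orP[/eqP emp|/existsP[k /andP[pk km]]].
      by rewrite symH -[X in H _ X]emp.
    by apply: path3 pk km _; rewrite symH.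
  have eqm u v : (u.+1%:R == v.+1%:R :> K) -> u = v.
    by rewrite eqr_nat eqSS => /eqP.
  rewrite /x; have [mi|mi] := boolP (m i \in S i); have [mj|mj] := boolP (m j \in S j).
  - by rewrite -natrD pnatr_eq0.
  - by rewrite subr_eq0 => /eqm /val_inj e; apply: far.
  - by rewrite addrC subr_eq0 => /eqm /val_inj e; rewrite symH; apply: far.
  - by rewrite -opprD oppr_eq0 -natrD pnatr_eq0.
have eS : S i :|: N i = S j :|: N j.
  by rewrite (SN i j) // (SN j i) 1?symH // finset.setUC.
have em : m i = m j.
  by rewrite /m eS; case: pickP => //= /(_ j); rewrite !inE eqxx.
have := mP i; rewrite finset.in_setU /x -em (SN j i) 1?symH // => /orP[mS|mN].
  by rewrite mS (negPf (disj _ _ mS)) subrr.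
rewrite mN; case: ifP => [mS|_]; last by rewrite addNr.
by have := disj _ _ mS; rewrite mN.
Qed.

(** * Lifts of rank at most two *)

(** A sum of two rank-one matrices factors through dimension two; a zero column and a zero row make
    the factors square. *)
Lemma det_rank2 (K : comNzRingType) (u w u' w' : 'I_3 -> K) :
  \det (\matrix_(i, j) (u i * w' j + w i * u' j)) = 0.
Proof.
pose P : 'M[K]_3 := \matrix_(i, j) triple (u i) (w i) 0 j.
pose Q : 'M[K]_3 := \matrix_(i, j) triple (w' j) (u' j) 0 i.
rewrite (_ : \matrix_(i, j) _ = P *m Q).
  rewrite det_mulmx (expand_det_col P ord_max) big1 ?mul0r // => i _.
  by rewrite mxE /triple /= mul0r.
by apply/matrixP => i j; rewrite !mxE big_ord3 !mxE /triple /= mul0r addr0.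
Qed.

Lemma hdeg_monom_mul (s d : RR) (a : hfin) :
  hdeg_is a d -> hdeg_is (hmonom s * a : hfin) (s + d).
Proof.
move=> [ad amin]; split=> [|x]; first by rewrite hmonom_mul [s + d]addrC addrK.
by rewrite hmonom_mul => /amin; rewrite lerBrDl.
Qed.

(* After scaling the diagonal of [A] to zero, the lift is
   [t^(s i + s j) (x i + x j)], where [x i] has order [2 * p i] and [p i] is the
   position of [i] on the axis; the coefficients of [x i] above its order are
   chosen so that those of [x i] and [x j] are opposite exactly up to order
   [B i j]. *)
Lemma rank2_lift (n : nat) (A : 'M[RR]_n) : A^T = A -> minors3_singular A ->
  exists L, sym_lift A L /\ hrank_le L 2.
Proof.
move=> trA singA; pose c i := A i i / 2; pose B := \matrix_(i, j) (A i j - c i - c j).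
have AB i j : A i j = B i j + c i + c j by rewrite mxE; lra.
have symA i j : A i j = A j i by rewrite -{1}trA mxE.
clear trA.
have symB i j : B i j = B j i by rewrite !mxE (symA i j); lra.
have B0 i : B i i = 0 by rewrite mxE /c; lra.
have sing := minors3_singular_shift AB singA.
have [p pP] := axis_positions symB B0 sing.
have /boolp.choice[lab labP] : forall r : RR, exists x : 'I_n -> CC,
    0 <= r -> forall i j, (x i + x j == 0) = (r < B i j).
  move=> r.
  have [r0|r0] := leP 0 r; last by exists (fun=> 0).
  have [|||x xP] := @antipodal_labels CC n (fun i j => r < B i j).
  - by move=> i j; rewrite symB.
  - by move=> i; rewrite B0; apply/negbTE; rewrite -leNgt.
  - by move=> i j k l; apply: path3_gt.
  - by exists x.
(* Using only levels that occur in [B] keeps supports finite, yet retains the level [B i j] where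
   cancellation must stop. *)
pose V := [fset B ij.1 ij.2 | ij in [set: 'I_n * 'I_n]]%fset.
have BV i j : B i j \in V by apply/imfsetP; exists (i, j); rewrite ?inE.
pose xf i e :=
  if (e - 2 * p i \in V) && (0 <= e - 2 * p i) then lab (e - 2 * p i) i else 0.
have xfin i : xf i \in finsupp.
  apply/finsuppP; exists [fset (2 * p i + r)%R | r in V]%fset => e eV.
  rewrite /xf; case: ifP => // /andP[rV _]; case/negP: eV.
  by apply/imfsetP; exists (e - 2 * p i); rewrite //= addrC subrK.
pose x i := HFin (xfin i).
have xlt i e : e < 2 * p i -> xf i e = 0.
  by move=> lt; rewrite /xf [0 <= _]leNgt subr_lt0 lt andbF.
(* Level 0 is in [V] because [B i i = 0], and its label is nonzero because [0 < B i i] fails. *)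
have x0 i : xf i (2 * p i) != 0.
  rewrite /xf subrr lexx -{1}(B0 i) BV /=.
  have := labP 0 (lexx 0) i i; rewrite B0 ltxx; apply: contraFneq => ->.
  by rewrite addr0.
have degx i j : hdeg_is (x i + x j : hfin) (B i j + p i + p j).
  have xE e : (x i + x j : hfin) e = xf i e + xf j e by [].
  have deglt u v : p u < p v -> hdeg_is (fun e => xf u e + xf v e) (2 * p u).
    move=> puv; split=> [|e]; first by rewrite [xf v _]xlt ?addr0 ?x0 //; lra.
    by apply: contraNT; rewrite -ltNge => e2; rewrite !xlt ?addr0 //; lra.
  have := pP i j; case: (axis_distP B i j) => -[Bij ->].
    have [pij|pij|pij] := ltgtP (p i) (p j) => e.
    - rewrite distrC gtr0_norm ?subr_gt0 // in e.
      have -> : B i j + p i + p j = 2 * p i by lra.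
      exact: deglt.
    - rewrite gtr0_norm ?subr_gt0 // in e.
      have -> : B i j + p i + p j = 2 * p j by lra.
      have -> : hfun (x i + x j) = (fun e => xf j e + xf i e).
        by apply: funext => y; rewrite xE addrC.
      exact: deglt.
    - by move: e; rewrite pij subrr normr0; lra.
  move=> /esym/eqP; rewrite normr_eq0 subr_eq0 => /eqP pij.
  split=> [|e]; rewrite xE /xf -pij.
    have -> : B i j + p i + p i - 2 * p i = B i j by lra.
    by rewrite BV Bij /= labP // ltxx.
  case: ifP => [/andP[_ r0]|_]; last by rewrite addr0 eqxx.
  by rewrite labP // -leNgt; lra.
(* This turns the order [B i j + p i + p j] of [x i + x j] into [B i j + c i + c j]. *)
pose s i := c i - p i.
pose L i j : hfin := hmonom (s i + s j) * (x i + x j).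
have degL i j : hdeg_is (L i j) (A i j).
  have -> : A i j = (s i + s j) + (B i j + p i + p j) by rewrite AB /s; lra.
  exact: hdeg_monom_mul.
exists (fun i j => hfun (L i j)); split.
  split=> [i j|]; first by rewrite /L addrC [x i + x j]addrC.
  split=> [i j|]; first exact: finsupp_hahn.
  split=> // i j L0; have [+ _] := degL i j; rewrite L0.
  by rewrite /hzero eqxx.
move=> f g _ _; rewrite -[RHS]/(hfun 0).
rewrite -(det_rank2 (fun i => hmonom (s (f i))) (fun i => hmonom (s (f i)) * x (f i))
  (fun i => hmonom (s (g i))) (fun i => hmonom (s (g i)) * x (g i))) -hdet_hfin.
congr hdet; apply: funext => i; apply: funext => j; rewrite mxE; congr hfun.
rewrite /L hmonomD; ring.
Qed.

Lemma det_rank1 (K : comNzRingType) (u w : 'I_2 -> K) :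
  \det (\matrix_(i, j) (u i * w j)) = 0.
Proof.
pose P : 'M[K]_2 := \matrix_(i, j) (if j == 0 then u i else 0).
pose Q : 'M[K]_2 := \matrix_(i, j) (if i == 0 then w j else 0).
rewrite (_ : \matrix_(i, j) _ = P *m Q).
  rewrite det_mulmx (expand_det_col P 1) big1 ?mul0r // => i _.
  by rewrite mxE /= mul0r.
by apply/matrixP => i j; rewrite !mxE !big_ord_recl big_ord0 !mxE /= mul0r !addr0.
Qed.

(** Monomials with exponents [A i j] suffice: the ties make these exponents a sum of a row term and
    a column term on each 2 x 2 submatrix. *)
Lemma rank1_lift (n : nat) (A : 'M[RR]_n) : A^T = A ->
  (forall f g : 'I_2 -> 'I_n, injective f -> injective g -> sym_trop_singular A f g) ->
  exists L, sym_lift A L /\ hrank_le L 1.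
Proof.
move=> trA sing.
have symA i j : A i j = A j i by rewrite -{1}trA mxE.
have degL i j : hdeg_is (hmonom (A i j)) (A i j).
  split=> [|e]; rewrite /= /monom; first by rewrite eqxx oner_neq0.
  by have [->//|_] := eqVneq e (A i j); rewrite eqxx.
exists (fun i j => hfun (hmonom (A i j))); split.
  split=> [i j|]; first by rewrite symA.
  split=> [i j|]; first exact: finsupp_hahn.
  split=> // i j L0; have [+ _] := degL i j; rewrite L0.
  by rewrite /hzero eqxx.
move=> f g injf injg; rewrite -[RHS]/(hfun 0).
rewrite -(det_rank1 (fun i => hmonom (A (f i) (g 0) - A (f 0) (g 0)))
  (fun j => hmonom (A (f 0) (g j)))) -hdet_hfin.
have [s1 [s2 [neq [e12 _]]]] := sing f g injf injg.
have ord2P (k : 'I_2) : k = 0 \/ k = 1.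
  by case: k => [[|[|//]] ?]; [left|right]; apply: val_inj.
have tie : A (f 0) (g 0) + A (f 1) (g 1) = A (f 0) (g 1) + A (f 1) (g 0).
  have {neq} neq : s1 != s2 by apply: contraNneq neq => ->.
  have valE (s : 'S_2) : trop_value A f g s = A (f 0) (g (s 0)) + A (f 1) (g (s 1)).
    rewrite /trop_value !big_ord_recl big_ord0 addr0.
    by rewrite (_ : lift ord0 ord0 = 1) //; apply: val_inj.
  have permP2 (s : 'S_2) : s 1 = 1 - s 0.
    have : s 0 != s 1 by rewrite (inj_eq perm_inj).
    by case: (ord2P (s 0)) (ord2P (s 1)) => -> [] -> // _; apply: val_inj.
  have s12 : s1 0 != s2 0.
    apply: contraNneq neq => e; apply/eqP/permP => i.
    by case: (ord2P i) => ->; rewrite // !permP2 e.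
  move: e12 s12; rewrite !valE !permP2.
  by case: (ord2P (s1 0)) (ord2P (s2 0)) => -> [] -> //; rewrite ?subrr ?subr0 => ->.
congr hdet; apply: funext => i; apply: funext => j.
rewrite !mxE -hmonomD; congr (hfun (hmonom _)).
by case: (ord2P i) (ord2P j) => -> [] ->; lra.
Qed.

Theorem theorem6 (n : nat) (A : 'M[RR]_n) :
  A^T = A -> (sym_kapranov_rank_is A 2 <-> sym_tropical_rank_is A 2).
Proof.
move=> trA; split=> [[[L [lift rk2]] minL]|[[f [g [injf injg nsing]]] sing]].
  split.
    (* Were all 2 x 2 submatrices singular, a lift of rank at most one would contradict
       minimality. *)
    apply: contrapT => nex; have [|L1 [lift1 rk1]] := rank1_lift trA.
      move=> f g injf injg; apply: contrapT => nsing; apply: nex.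
      by exists f, g.
    by have := minL _ lift1 _ rk1.
  have sing3 : minors3_singular A.
    move=> f g injf injg; apply: (singular_of_hdet0 _ _ _ lift) => //.
    exact: rk2.
  elim=> // r IHr; rewrite ltnS leq_eqVlt => /orP[/eqP <-//|r2].
  exact: singular_succ (IHr r2).
have [L liftrk] := rank2_lift trA (sing 3 isT).
split; first by exists L.
move=> {liftrk} {}L lift [|[|//]] rk; last first.
  by case: nsing; apply: (singular_of_hdet0 _ _ _ lift) => //; apply: rk.
(* Rank zero would make a 1 x 1 submatrix singular, but one point has a single permutation, hence a
   single monomial. *)
have inj1 (h : 'I_1 -> 'I_n) : injective h by move=> i j _; rewrite !ord1.
have [] := @singular_of_hdet0 n 1 A L (fun=> f 0) (fun=> g 0) isT (inj1 _) (inj1 _)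
  lift.
  by apply: rk; apply: inj1.
move=> s1 [s2 [/eqP[]]]; congr sym_monomial.
by apply/permP => i; rewrite !ord1.
Qed.
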